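(* Let $(X,d,T)$ be a topological dynamical system and $\mu\in M(X,T)$. Then $(X,T)$ is $\mu$-$F$-equicontinuous.
   Context: A topological dynamical system $(X,d,T)$ consists of a compact metric space $X$ with metric $d$ and a continuous map $T:X\to X$. $M(X,T)$ is the set of all $T$-invariant Borel probability measures on $X$. The weak-mean pseudometric is $$F(x,y)=\limsup_{n\to\infty}\frac1n\inf_{\sigma\in S_n}\sum_{k=0}^{n-1}d(T^kx,T^{\sigma(k)}y),$$ where $S_n$ is the set of all permutations of $\{0,1,\ldots,n-1\}$. $(X,T)$ is $\mu$-$F$-equicontinuous if for every $\tau>0$ there exists a compact set $M\subset X$ with $\mu(M)>1-\tau$ such that for every $\epsilon>0$ there exists $\delta>0$ such that for all $x,y\in M$, $d(x,y)<\delta$ implies $F(x,y)<\epsilon$. *)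

(* Defs.v *)
From HB Require Import structures.
From mathcomp Require Import all_boot all_order all_fingroup all_algebra.
From mathcomp Require Import all_classical all_reals all_analysis.

Set Implicit Arguments.
Unset Strict Implicit.
Unset Printing Implicit Defensive.

Import Order.TTheory GRing.Theory Num.Theory.
Import numFieldNormedType.Exports.

Local Open Scope classical_set_scope.
Local Open Scope ring_scope.

(* Measurable types of the library are pointed; a space that carries a
   probability measure is nonempty, so a base point costs no generality. *)
#[short(type="pmetricType")]
HB.structure Definition PointedMetric (R : numDomainType) :=
  {X of Pointed X & Metric R X}.

Notation borelType X := (g_sigma_algebraType (@open X)).

Definition invariant_measure (R : realType) (X : pmetricType R) (T : X -> X)
    (mu : probability (borelType X) R) : Prop :=
  forall A : set (borelType X), measurable A -> mu (T @^-1` A) = mu A.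

(* The index n = 0 contributes 0 * 0, which does not affect the limsup.  The
   limsup is taken in \bar R, where it always exists. *)
Definition weak_mean_dist (R : realType) (X : metricType R) (T : X -> X)
    (x y : X) : \bar R :=
  limn_esup (fun n : nat =>
    (n%:R^-1 * inf (range (fun s : 'S_n =>
       \sum_(k < n) mdist (iter k T x) (iter (s k) T y))))%:E).

Definition mu_F_equicontinuous (R : realType) (X : pmetricType R) (T : X -> X)
    (mu : probability (borelType X) R) : Prop :=
  forall tau : R, 0 < tau ->
  exists M : set X, [/\ compact M, ((1 - tau)%:E < mu M)%E &
    forall e : R, 0 < e -> exists2 d : R, 0 < d &
      forall x y : X, M x -> M y -> mdist x y < d ->
        (weak_mean_dist T x y < e%:E)%E].

(* Main.v *)
Require Import Defs.
From mathcomp Require Import all_boot all_order all_fingroup all_algebra.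
From mathcomp Require Import all_classical all_reals all_analysis.
From mathcomp Require Import measurable_realfun borel_hierarchy.
From mathcomp Require Import zify ring lra.

(** Two orbits that visit every cell of a fine finite partition equally often,
    up to a small proportion of the time, can be matched by a permutation so
    that most matched points lie in a common cell.  Hence [weak_mean_dist T x y]
    is small as soon as the visit frequencies of x and y to the cells are close
    ([exists_matching], [weak_mean_dist_le]), and the theorem becomes an
    assertion about frequencies of visits.

    By the pointwise ergodic theorem these frequencies exist almost everywhere,
    and by Lusin's theorem they are continuous on a large compact set.  Only
    traces of both theorems are proved here.  The frequencies are encoded by
    countably many Borel sets: [excess T P b] consists of the points x for which
    the number of visits to P before time n, minus b n, is unbounded above; up
    to the borderline case this says that the upper frequency of visits of x to
    P exceeds b.  The ergodic theorem is used in the form that, for a < b,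
    almost no point has upper frequency above b and lower frequency below a
    ([measure_excess_gap]); its proof is the covering argument of Katznelson and
    Weiss, which cuts an orbit into blocks on each of which the frequency is at
    least b ([visits_ge_blocks]).  Off these exceptional sets, membership in
    finitely many sets [excess T P b] determines the frequency up to a small
    error ([visits_close_of_levels]).

    What remains of Lusin's theorem is the following consequence of inner
    regularity by closed sets: for countably many Borel sets there is a compact
    set of measure close to 1 on which each of them is locally constant at a
    uniform scale ([borel_locally_constant_seq]).  It is applied to the sets
    [excess T P b] with P in one of countably many finite partitions of mesh
    tending to 0 and b rational. *)

Set Implicit Arguments.
Unset Strict Implicit.
Unset Printing Implicit Defensive.

Import Order.TTheory GRing.Theory Num.Theory.
Import numFieldNormedType.Exports.

Local Open Scope classical_set_scope.
Local Open Scope ring_scope.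

(** * Matching two finite families by their labels *)

(** A permutation maximizing the number of agreements works.  If, for some label
    i, both a point of u and a point of v labelled i were left in disagreement,
    swapping their partners would create an agreement and destroy none; so for
    each i one of the two sides is fully matched, and the unmatched points of u
    labelled i are just the surplus of i in u over v. *)
Lemma exists_matching (n m : nat) (u v : 'I_n -> 'I_m) :
  exists s : 'S_n, (#|[set k | u k != v (s k)]%SET| <=
    \sum_(i < m) (#|[set k | u k == i]%SET| - #|[set k | v k == i]%SET|))%N.
Proof.
pose agree (s : 'S_n) := #|[set k | u k == v (s k)]%SET|.
have [s _ smax] := @arg_maxnP 'S_n 1%g xpredT agree isT.
exists s.
rewrite -sum1_card (eq_bigl (fun k => u k != v (s k))); last first.
  by move=> k; rewrite inE.
rewrite (partition_big u xpredT) //=; apply: leq_sum => i _.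
pose A := [set k | (u k == i) && (v (s k) == i)]%SET.
pose B := [set k | (u k == i) && (v (s k) != i)]%SET.
pose C := [set k | (u k != i) && (v (s k) == i)]%SET.
(* On label i, A counts the agreements, B the unmatched points of u and C the
   unmatched points of v. *)
have eB : (\sum_(k | (u k != v (s k)) && (u k == i)) 1 = #|B|)%N.
  rewrite -sum1_card; apply: eq_bigl => k; rewrite inE.
  by case: (eqVneq (u k) i) => [->|]; rewrite ?andbT ?andbF //= eq_sym.
have eu : #|[set k | u k == i]%SET| = (#|A| + #|B|)%N.
  rewrite -cardsUI (_ : A :|: B = [set k | u k == i])%SET; last first.
    by apply/setP => k; rewrite !inE -andb_orr orbN andbT.
  rewrite (_ : A :&: B = finset.set0)%SET ?cards0 ?addn0 //.
  by apply/setP => k; rewrite !inE; case: (v (s k) == i); rewrite /= ?andbF.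
have ev : #|[set k | v k == i]%SET| = (#|A| + #|C|)%N.
  rewrite -(card_preimset [set k | v k == i]%SET (@perm_inj _ s)).
  rewrite -cardsUI (_ : A :|: C = s @^-1: [set k | v k == i])%SET; last first.
    by apply/setP => k; rewrite !inE -andb_orl orbN andTb.
  rewrite (_ : A :&: C = finset.set0)%SET ?cards0 ?addn0 //.
  by apply/setP => k; rewrite !inE; case: (u k == i); rewrite /= ?andbF.
rewrite eB eu ev subnDl.
have [->|[k]] := set_0Vmem B; first by rewrite cards0.
have [->|[l]] := set_0Vmem C; first by rewrite cards0 subn0.
rewrite !inE => /andP[ul vl] /andP[uk vk].
have kl : k != l by apply: contraNneq vk => ->.
have := smax (tperm k l * s)%g isT.
rewrite /= leqNgt => /negP[]; apply: proper_card; apply/fintype.properP; split.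
  apply/fintype.subsetP => j; rewrite !inE permM => uj.
  case: tpermP => [jk|jl|//].
    by rewrite jk (eqP uk) (eqP vl).
  by move: uj ul; rewrite jl (eqP vl) => /eqP->; rewrite eqxx.
exists k; rewrite !inE ?permM ?tpermL (eqP uk) ?(eqP vl) //.
by rewrite eq_sym.
Qed.

(** * Frequencies of visits along an orbit *)

Definition visits (R : realType) (X : Type) (T : X -> X) (P : set X) (n : nat)
    (x : X) : R := \sum_(k < n) \1_P (iter k T x).

(** Up to the borderline case of equality, this says that the upper frequency
    of visits to P exceeds b.  Unlike a
    strict inequality for the upper limit, unboundedness
    is expressed by countable set operations without any limit, and dropping
    the first point of the orbit does not affect it. *)
Definition excess (R : realType) (X : Type) (T : X -> X) (P : set X) (b : R) :
    set X :=
  [set x | forall K : nat, exists n, b * n%:R + K%:R <= visits R T P n x].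

Arguments visits {R X} T P n x.
Arguments excess {R X} T P b.

Section Visits.
Context {R : realType} {X : Type} (T : X -> X).
Implicit Types (P Q E : set X) (b : R).

Lemma visits0 P x : visits T P 0 x = 0 :> R.
Proof. by rewrite /visits big_ord0. Qed.

Lemma visitsD P m n x :
  visits T P (m + n) x = visits T P m x + visits T P n (iter m T x) :> R.
Proof.
rewrite /visits big_split_ord/=; congr (_ + _); apply: eq_bigr => k _.
by rewrite addnC iterD.
Qed.

Lemma visitsC P n x : visits T (~` P) n x = n%:R - visits T P n x :> R.
Proof.
apply: (canRL (addrK _)).
rewrite /visits -big_split/= (eq_bigr (fun=> 1)) ?sumr_const ?card_ord// => k _.
by rewrite !indicE in_setC; case: (_ \in P); rewrite ?addr0 ?add0r.
Qed.

Lemma visits_ge0 P n x : 0 <= visits T P n x :> R.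
Proof. by apply: sumr_ge0 => k _; rewrite indicE. Qed.

Lemma visits_le P n x : visits T P n x <= n%:R :> R.
Proof. by rewrite -subr_ge0 -visitsC visits_ge0. Qed.

Lemma iter_stable E : E `<=` T @^-1` E -> forall k x, E x -> E (iter k T x).
Proof. by move=> ET; elim=> //= k IH x Ex; apply/ET/IH. Qed.

Lemma visits_le_on P Q E n x : E `<=` T @^-1` E -> P `&` E `<=` Q -> E x ->
  visits T P n x <= visits T Q n x :> R.
Proof.
move=> ET PEQ Ex; apply: ler_sum => k _; rewrite !indicE ler_nat.
have Ek := iter_stable ET k Ex.
have [Pk|//] := boolP (_ \in P); rewrite lt0b.
by apply/mem_set/PEQ; split=> //; exact: set_mem.
Qed.

(** The orbit of a point of E is cut into successive blocks of length at most
    N, each containing a proportion at least b of visits to Q; stability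
    of E restarts the construction at the end of each block.  Only the last,
    incomplete block is lost, whence the N on the left. *)
Lemma visits_ge_blocks E Q b N : 0 <= b -> E `<=` T @^-1` E ->
  (forall x, E x ->
    exists n, [/\ (0 < n)%N, (n <= N)%N & b * n%:R <= visits T Q n x]) ->
  forall L x, E x -> b * (L%:R - N%:R) <= visits T Q L x.
Proof.
move=> b0 ET block; elim/ltn_ind => L IH x Ex.
have [LN|NL] := leqP L N.
  (* Fewer than one full block: the lower bound is nonpositive. *)
  apply: le_trans (visits_ge0 _ _ _).
  by rewrite mulr_ge0_le0// subr_le0 ler_nat.
have [n [n0 nN bn]] := block x Ex.
have nL : (n <= L)%N by lia.
have := IH (L - n)%N ltac:(lia) _ (iter_stable ET n Ex).
have := @visitsD Q n (L - n) x; rewrite subnKC// => ->.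
rewrite natrB//; move: bn.
move: (visits _ _ _ _) (visits _ _ _ _) => u v; lra.
Qed.

(** Dropping the first point changes the number of visits by at most 1. *)
Lemma excess_stable P b : 0 <= b -> excess T P b `<=` T @^-1` excess T P b.
Proof.
move=> b0 x Px K; have [[|n]] := Px K.+1.
  by rewrite visits0 mulr0 add0r lern0.
move=> h; exists n; move: h; rewrite -addn1 addnC visitsD /=.
have := visits_le P 1 x.
rewrite natrD -(natr1 K); move: (visits _ _ _ _) (visits _ _ _ _) => u v; lra.
Qed.

Lemma excess_block P b x : excess T P b x ->
  exists2 n, (0 < n)%N & b * n%:R <= visits T P n x.
Proof.
move=> /(_ 1%N)[[|n]]; first by rewrite visits0 mulr0 add0r ler10.
by exists n.+1 => //; lra.
Qed.

Lemma excess_lt1 P b x : excess T P b x -> b < 1.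
Proof.
move=> /(_ 1%N)[n bn]; have {bn} := le_trans bn (visits_le P n x).
case: n => [|n]; first by rewrite mulr0 add0r ler10.
have : 0 < n.+1%:R :> R by rewrite ltr0n.
by move: (n.+1%:R) => t; nra.
Qed.

Lemma not_excess P b x : ~ excess T P b x ->
  exists K : nat, forall n, visits T P n x <= b * n%:R + K%:R.
Proof.
move=> /existsNP[K /forallNP PK]; exists K => n.
by have /negP := PK n; rewrite -ltNge => /ltW.
Qed.

(** Let l be the first level with x outside [excess T P (l / K.+1)].  The
    upper frequency of x is at most l / K.+1.  If l >= 2, then y lies in the
    set of the level below; having no gap there, y has lower frequency at least
    two levels below l. *)
Lemma visits_close_of_levels K (P : set X) x y :
  (forall l, (l <= K)%N ->
    excess T P (l%:R / K.+1%:R : R) x <-> excess T P (l%:R / K.+1%:R : R) y) ->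
  (forall l, ~ (excess T P (l.+1%:R / K.+1%:R : R) `&`
    excess T (~` P) (1 - l%:R / K.+1%:R : R)) y) ->
  exists C : nat, forall n,
    visits T P n x - visits T P n y <= 2 / K.+1%:R * n%:R + C%:R :> R.
Proof.
move=> xy ygap; pose p l := `[< ~ excess T P (l%:R / K.+1%:R : R) x >].
have pK : p K.+1.
  apply/asboolP => xK; have := excess_lt1 xK.
  by rewrite divff ?ltxx// pnatr_eq0.
have exp : exists l, p l by exists K.+1.
case: (ex_minnP exp) => l0 pl0 lmin; have [C xC] := not_excess (asboolW pl0).
have lK : (l0 <= K.+1)%N by exact: lmin.
have K0 : 0 < K.+1%:R^-1 :> R by rewrite invr_gt0 ltr0n.
(* For l0 <= 1 the lower bound for y is the nonnegativity of visits. *)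
clear pl0; case: l0 => [|[|l]] in xC lmin lK *.
- exists C => n; have := xC n; have := visits_ge0 P n y.
  have : 0 <= n%:R :> R by [].
  move: (K.+1%:R^-1) K0 (visits _ _ _ _) (visits _ _ _ _) => k k0 a b; nra.
- exists C => n; have := xC n; have := visits_ge0 P n y.
  have : 0 <= n%:R :> R by [].
  move: (K.+1%:R^-1) K0 (visits _ _ _ _) (visits _ _ _ _) => k k0 a b; nra.
have xl : excess T P (l.+1%:R / K.+1%:R : R) x.
  apply: contrapT => nx; have := lmin l.+1; rewrite ltnn => h.
  by apply: notF; apply: h; exact/asboolP.
have yl : excess T P (l.+1%:R / K.+1%:R : R) y by apply/xy.
have nyc : ~ excess T (~` P) (1 - l%:R / K.+1%:R : R) y.
  by move=> yc; exact: (ygap l).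
have [C' yC'] := not_excess nyc; exists (C + C')%N => n.
have := xC n; have := yC' n; rewrite visitsC -[l.+2]addn2 !natrD.
have : 0 <= n%:R :> R by [].
move: (K.+1%:R^-1) K0 (visits _ _ _ _) (visits _ _ _ _) => k k0 a b; lra.
Qed.

End Visits.

Section MeasurePreserving.
Context {d : measure_display} {R : realType} {X : measurableType d}.
Variables (mu : probability X R) (T : X -> X).
Hypotheses (mT : measurable_fun setT T)
  (muT : forall A, measurable A -> mu (T @^-1` A) = mu A).
Implicit Types (P Q E : set X) (b : R).

Let measurable_iter k : measurable_fun setT (iter k T).
Proof.
by elim: k => [|k IH]; [exact: measurable_id|exact: measurableT_comp].
Qed.

Let measurable_preimage_iter k P :
  measurable P -> measurable (iter k T @^-1` P).
Proof.
by move=> mP; rewrite -[X in measurable X]setTI; exact: measurable_iter.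
Qed.

Let measure_iter k P : measurable P -> mu (iter k T @^-1` P) = mu P.
Proof.
elim: k P => // k IH P mP.
have -> : iter k.+1 T @^-1` P = iter k T @^-1` (T @^-1` P) by [].
rewrite IH ?muT// -[X in measurable X]setTI; exact: mT.
Qed.

Lemma measurable_visits P n : measurable P ->
  measurable_fun setT (visits T P n : X -> R).
Proof.
move=> mP; apply: measurable_sum => k.
by apply: measurableT_comp => //; exact: measurable_indic.
Qed.

Lemma measurable_visits_ge P n (c : R) : measurable P ->
  measurable [set x | c <= visits T P n x].
Proof.
move=> mP.
have := measurable_visits n mP measurableT (measurable_itv `[c, +oo[).
rewrite setTI; congr measurable; apply/seteqP.
by split => x /=; rewrite in_itv/= andbT.
Qed.

Lemma measurable_excess P b : measurable P -> measurable (excess T P b).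
Proof.
move=> mP.
have -> : excess T P b =
    \bigcap_K \bigcup_n [set x | b * n%:R + K%:R <= visits T P n x].
  apply/seteqP; split => [x Px K _|x Px K].
    by have [n] := Px K; exists n.
  by have [n _] := Px K I; exists n.
apply: bigcap_measurable => [|K _]; first by exists 0%N.
by apply: bigcup_measurable => n _; exact: measurable_visits_ge.
Qed.

(** By invariance each time k contributes at most mu P. *)
Lemma integral_visits E P n : measurable E -> measurable P ->
  (\int[mu]_(x in E) (visits T P n x)%:E <= n%:R%:E * mu P)%E.
Proof.
move=> mE mP; rewrite /visits.
under eq_integral do rewrite -sumEFin.
rewrite ge0_integral_sum//; last first.
- move=> k; apply/measurable_EFinP; apply: measurable_funTS.
  by apply: measurableT_comp => //; exact: measurable_indic.
apply: (@le_trans _ _ (\sum_(k < n) mu P)%E).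
  apply: lee_sum => k _; rewrite -[leRHS](measure_iter k)//.
  have mk := measurable_preimage_iter k mP.
  rewrite (_ : (fun x => _) = (fun x => (\1_(iter k T @^-1` P) x)%:E)).
    rewrite integral_indic//; apply: le_measure; rewrite ?inE//.
    exact: measurableI.
  by apply/funext => x; rewrite !indicE.
by rewrite sumr_const card_ord mule_natl.
Qed.

(** Integrating [visits_ge_blocks] over E gives
    b (L - N) mu E <= L mu Q for all large L; divide by L and let L tend to
    infinity. *)
Lemma measure_ge_blocks E Q b N : 0 <= b -> measurable E -> measurable Q ->
  E `<=` T @^-1` E ->
  (forall x, E x ->
    exists n, [/\ (0 < n)%N, (n <= N)%N & b * n%:R <= visits T Q n x]) ->
  (b%:E * mu E <= mu Q)%E.
Proof.
move=> b0 mE mQ ET block.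
have key L : (N <= L)%N ->
    ((b * (L%:R - N%:R))%R%:E * mu E <= L%:R%:E * mu Q)%E.
  move=> NL; apply: le_trans (integral_visits L mE mQ).
  rewrite -integral_cst//; apply: ge0_le_integral => //=.
  - by move=> x _; rewrite lee_fin mulr_ge0// subr_ge0 ler_nat.
  - apply/measurable_EFinP; apply: measurable_funTS.
    exact: measurable_visits.
  - by move=> x Ex; rewrite lee_fin; exact: visits_ge_blocks Ex.
have fE : mu E \is a fin_num by apply: fin_num_measure.
have fQ : mu Q \is a fin_num by apply: fin_num_measure.
move: key; rewrite -(fineK fE) -(fineK fQ).
have : fine (mu E) <= 1 by rewrite -lee_fin fineK// probability_le1.
have : 0 <= fine (mu E) by apply: fine_ge0.
move: (fine (mu E)) (fine (mu Q)) => e q e0 e1 key.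
rewrite -EFinM lee_fin leNgt; apply/negP => qbe.
pose L := (N + Num.truncn (b * N%:R / (b * e - q))).+1.
have hL : b * N%:R / (b * e - q) < L%:R.
  rewrite /L -addnS natrD; apply: lt_le_trans (truncnS_gt _) _.
  by rewrite lerDr.
have := key L ltac:(rewrite /L; lia).
rewrite -!EFinM lee_fin.
move: hL; rewrite ltr_pdivrMr ?subr_gt0// => hL.
have : b * N%:R * e <= b * N%:R by rewrite ler_piMr// mulr_ge0.
nra.
Qed.

(** A form of the maximal ergodic inequality.  The waiting time until the
    frequency reaches b is finite but not bounded on E.  Points whose waiting
    time exceeds N are added to the target set, which gives them a block of
    length 1, as b <= 1; their measure tends to 0 as N tends to infinity. *)
Lemma measure_ge_frequency E P b : 0 <= b -> measurable E -> measurable P ->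
  E `<=` T @^-1` E ->
  (forall x, E x -> exists2 n, (0 < n)%N & b * n%:R <= visits T P n x) ->
  (b%:E * mu E <= mu (P `&` E))%E.
Proof.
move=> b0 mE mP ET freq.
pose F N := E `&` \bigcup_(n in [set n | (0 < n <= N)%N])
  [set x | b * n%:R <= visits T P n x].
have mF N : measurable (F N).
  apply: measurableI => //; apply: bigcup_measurable => n _.
  exact: measurable_visits_ge.
have FE : \bigcup_N F N = E.
  apply/seteqP; split=> [x [N _ []]//|x Ex].
  have [n n0 bn] := freq x Ex; exists n => //; split=> //.
  by exists n => //=; rewrite n0/=.
have ndF : nondecreasing_seq F.
  move=> m n mn; apply/subsetPset; apply: setIS => x [k /= /andP[k0 km] ?].
  by exists k => //=; rewrite k0 (leq_trans km).
have cF : (fun N => mu (P `&` E) + (mu E - mu (F N)))%E @ \oo -->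
    (mu (P `&` E) + (mu E - mu E))%E.
  have fE : mu E \is a fin_num by apply: fin_num_measure.
  have fPE : mu (P `&` E) \is a fin_num.
    by apply: fin_num_measure; exact: measurableI.
  apply: cvgeD; first by rewrite fin_num_adde_defr.
    exact: cvg_cst.
  apply: cvgeB; first by rewrite fin_num_adde_defr.
    exact: cvg_cst.
  by rewrite -[X in _ --> mu X]FE; apply: nondecreasing_cvg_mu; rewrite ?FE.
rewrite subee ?adde0 in cF; last by apply: fin_num_measure.
rewrite -(cvg_lim _ cF)//; apply: lime_ge.
  by apply/cvg_ex; eexists; exact: cF.
apply: nearW => N.
apply: (@le_trans _ _ (mu ((P `&` E) `|` (E `\` F N)))).
  apply: (@measure_ge_blocks E _ b N.+1) => //.
    by apply: measurableU; [exact: measurableI|exact: measurableD].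
  move=> x Ex; have [[_ [n /= /andP[n0 nN] bn]]|nF] := pselect (F N x).
    exists n; split => //; first exact: leqW.
    by apply: (le_trans bn); apply: (visits_le_on n ET _ Ex); exact: subsetUl.
  exists 1%N; split => //; rewrite mulr1 /visits big_ord1 /= indicE mem_set.
    have [n n0 bn] := freq x Ex.
    have := le_trans bn (visits_le T P n x).
    by rewrite ger_pMl// ltr0n.
  by right; split.
apply: (le_trans (measureU2 _ _ _)) => /=.
- exact: measurableI.
- exact: measurableD.
rewrite leeD2l// measureD//; last by rewrite ltey_eq fin_num_measure.
by rewrite (_ : E `&` F N = F N)// /F setIA setIid.
Qed.

(** For a > 1 the intersection E is empty.  Otherwise E is stable, and
    [measure_ge_frequency] applies on it to P with b and to the complement of P
    with 1 - a.  Adding up, (1 + b - a) mu E <= mu E, which forces mu E = 0. *)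
Lemma measure_excess_gap P a b : 0 <= b -> a < b -> measurable P ->
  mu (excess T P b `&` excess T (~` P) (1 - a)) = 0%E.
Proof.
move=> b0 ab mP; set E := excess T P b `&` _.
have [a1|a1] := leP a 1; last first.
  rewrite (_ : E = set0) ?measure0//; apply/seteqP; split => // x [Px _].
  by have := excess_lt1 Px; lra.
have a1' : 0 <= 1 - a by rewrite subr_ge0.
have mPC : measurable (~` P) by exact: measurableC.
have mE : measurable E by apply: measurableI; exact: measurable_excess.
have ET : E `<=` T @^-1` E.
  by move=> x [Px Cx]; split; exact: excess_stable.
have := leeD (measure_ge_frequency b0 mE mP ET (fun x Ex => excess_block Ex.1))
  (measure_ge_frequency a1' mE mPC ET (fun x Ex => excess_block Ex.2)).
rewrite -measureU; last 3 first.
- exact: measurableI.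
- exact: measurableI.
- by rewrite setIACA setICr set0I.
rewrite -setIUl setUv setTI.
have fE : mu E \is a fin_num by apply: fin_num_measure.
rewrite -(fineK fE) -[leRHS](fineK fE) -!EFinM -EFinD lee_fin => h.
have : 0 <= fine (mu E) by apply: fine_ge0.
by move: h; move: (fine _) => e h e0; congr EFin; nra.
Qed.

End MeasurePreserving.

(** * Inner regularity of Borel probability measures on a metric space *)

Lemma open_mdist_ball {R : realType} {X : metricType R} (c : X) (r : R) :
  open [set x | mdist c x < r].
Proof.
rewrite openE => x /= cx.
rewrite /interior -metricType_numDomainType.filter_from_mdist_nbhs.
exists (r - mdist c x) => /=; first by rewrite subr_gt0.
move=> y /= xy; apply: (le_lt_trans (metric_triangle _ x _)).
by rewrite addrC -ltrBrDr.
Qed.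

Lemma measure_bigcup_geometric {d : measure_display} {R : realType}
    {X : measurableType d} (mu : {measure set X -> \bar R}) (F : nat -> set X)
    (e : R) :
  0 <= e -> (forall n, measurable (F n)) ->
  (forall n, (mu (F n) <= (e / (2 ^ n.+1)%:R)%:E)%E) ->
  (mu (\bigcup_n F n) <= e%:E)%E.
Proof.
move=> e0 mF Fe; apply: le_trans (epsilon_trick0 xpredT e0).
apply: (@le_trans _ _ (\sum_(n <oo) mu (F n))%E).
  by apply: measure_sigma_subadditive => //; exact: bigcup_measurable.
by apply: lee_nneseries.
Qed.

(** Each point of C has a neighbourhood whose distance to D is bounded below;
    compactness makes the bound uniform. *)
Lemma compact_closed_apart {R : realType} {X : metricType R} (C D : set X) :
  compact C -> closed D -> C `&` D = set0 ->
  exists2 e : R, 0 < e & forall x y, C x -> D y -> e <= mdist x y.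
Proof.
move=> cC cD CD.
have near_pt x : C x -> \forall x' \near x & e \near (0:R)^'+,
    forall y, D y -> e <= mdist x' y.
  move=> Cx.
  have nDx : (~` D) x by move=> Dx; have : (C `&` D) x by []; rewrite CD.
  have : nbhs x (~` D).
    by apply: open_nbhs_nbhs; split => //; exact: closed_openC.
  rewrite -metricType_numDomainType.filter_from_mdist_nbhs => -[r /= r0 rD].
  exists (ball x (r / 2), [set e | e <= r / 2]) => /=.
    split; first by apply: nbhsx_ballx; rewrite divr_gt0.
    by apply: nbhs_right_le; rewrite divr_gt0.
  move=> [x' e] /= []; rewrite ballEmdist /= => xx' er y Dy.
  rewrite leNgt; apply/negP => x'y; apply: (rD y) => //=.
  by apply: (le_lt_trans (metric_triangle _ x' _)); lra.
have H := (compact_near_coveringP C).1 cC R (0 : R)^'+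
  (fun e x => forall y, D y -> e <= mdist x y) _ near_pt.
case: H => r /= r0 h; exists (r / 2) => [|x y Cx]; first by rewrite divr_gt0.
apply: (h (r / 2)) => //=; last by rewrite divr_gt0.
by rewrite sub0r normrN gtr0_norm ?divr_gt0//; lra.
Qed.

(** U is the union of the sets of points at distance at least 1 / n.+1 from its
    complement. *)
Lemma open_Fsigma {R : realType} {X : metricType R} (U : set X) :
  open U -> Fsigma U.
Proof.
move=> oU; exists (fun n =>
    \bigcap_(y in ~` U) ~` [set x | mdist y x < n.+1%:R^-1]).
  by move=> n; apply: closed_bigI => y _; apply/open_closedC/open_mdist_ball.
apply/seteqP; split => [x Ux|x [n _ Fx]].
  have : nbhs x U by apply: open_nbhs_nbhs.
  rewrite -metricType_numDomainType.filter_from_mdist_nbhs => -[r /= r0 rU].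
  exists (Num.truncn r^-1) => //= y nUy yx; apply/nUy/rU => /=.
  rewrite metric_sym; apply: (lt_le_trans yx).
  by rewrite invf_ple ?posrE// ltW// truncnS_gt.
apply: contrapT => nUx; apply: (Fx x nUx) => /=.
by rewrite mdistxx invr_gt0 ltr0Sn.
Qed.

Section Regularity.
Context {R : realType} {X : pmetricType R}.
Variable mu : probability (borelType X) R.
Implicit Types (A C : set (borelType X)).

Definition closed_approx A := forall e : R, 0 < e ->
  exists C, [/\ @closed X C, C `<=` A & (mu (A `\` C) <= e%:E)%E].

Lemma closed_borel (C : set X) : closed C -> measurable (C : set (borelType X)).
Proof.
move=> cC; rewrite -[C]setCK; apply: measurableC.
by apply: sub_sigma_algebra; exact: closed_openC.
Qed.

Lemma closed_approx_family (A : nat -> set (borelType X)) e : 0 < e ->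
  (forall n, closed_approx (A n)) ->
  exists C : nat -> set X, forall n,
   [/\ closed (C n), C n `<=` A n &
     (mu (A n `\` C n) <= (e / (2 ^ n.+1)%:R)%:E)%E].
Proof.
move=> e0 AA.
suff /choice[C CA] : forall n, exists C : set X, [/\ closed C, C `<=` A n &
    (mu (A n `\` C) <= (e / (2 ^ n.+1)%:R)%:E)%E] by exists C.
by move=> n; apply: AA; rewrite divr_gt0// ltr0n expn_gt0.
Qed.

Lemma closed_approx_closed (C : set X) : closed C -> closed_approx C.
Proof.
by move=> cC e e0; exists C; split => //; rewrite setDv measure0 lee_fin ltW.
Qed.

Lemma closed_approx_bigcap (A : nat -> set (borelType X)) :
  (forall n, measurable (A n)) -> (forall n, closed_approx (A n)) ->
  closed_approx (\bigcap_n A n).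
Proof.
move=> mA AA e e0; have [C CA] := closed_approx_family e0 AA.
have mC n : measurable (C n : set (borelType X)).
  by apply: closed_borel; case: (CA n).
exists (\bigcap_n C n); split.
- by apply: closed_bigI => n _; case: (CA n).
- by move=> x Cx n _; have [_ + _] := CA n; apply; exact: Cx.
have m n : measurable (A n `\` C n) by exact: measurableD.
apply: le_trans (measure_bigcup_geometric (mu := mu) (ltW e0) m _); last first.
  by move=> n; case: (CA n).
apply: le_measure; rewrite ?inE.
- by apply: measurableD; apply: bigcapT_measurable.
- exact: bigcupT_measurable.
move=> x [Ax] /existsNP[n /not_implyP[_ nC]]; exists n => //.
by split => //; exact: Ax.
Qed.

(** The union of closed approximations need not be closed, but its finite
    subunions are, and they exhaust it up to small measure. *)
Lemma closed_approx_bigcup (A : nat -> set (borelType X)) :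
  (forall n, measurable (A n)) -> (forall n, closed_approx (A n)) ->
  closed_approx (\bigcup_n A n).
Proof.
move=> mA AA e e0; have e20 : 0 < e / 2 by rewrite divr_gt0.
have [C CA] := closed_approx_family e20 AA.
have mC n : measurable (C n : set (borelType X)).
  by apply: closed_borel; case: (CA n).
pose D N : set X := \big[setU/set0]_(n < N) C n.
have mD N : measurable (D N : set (borelType X)) by exact: bigsetU_measurable.
have mUA : measurable (\bigcup_n A n) by exact: bigcupT_measurable.
have lt_e : (mu (\bigcap_N (\bigcup_n A n `\` D N)) < e%:E)%E.
  apply: (@le_lt_trans _ _ (e / 2)%:E); last by rewrite lte_fin; lra.
  have m n : measurable (A n `\` C n) by exact: measurableD.
  apply: le_trans (measure_bigcup_geometric (mu := mu) (ltW e20) m _);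
    last by move=> n; case: (CA n).
  apply: le_measure; rewrite ?inE.
  - by apply: bigcapT_measurable => N; exact: measurableD.
  - exact: bigcupT_measurable.
  move=> x Ax; have [[n _ An] _] := Ax 0%N I; exists n => //; split => // Cn.
  by have [_] := Ax n.+1 I; apply; rewrite /D big_ord_recr; right.
have cvgD : mu \o (fun N => \bigcup_n A n `\` D N) @ \oo -->
    mu (\bigcap_N (\bigcup_n A n `\` D N)).
  apply: nonincreasing_cvg_mu.
  - by rewrite ltey_eq fin_num_measure//; exact: measurableD.
  - by move=> N; exact: measurableD.
  - by apply: bigcapT_measurable => N; exact: measurableD.
  - move=> m n mn; apply/subsetPset; apply: setDS; exact: subset_bigsetU.
have : \forall N \near \oo, (mu (\bigcup_n A n `\` D N) < e%:E)%E.
  exact: cvgD (open_ereal_lt' lt_e).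
move=> [N _ /(_ N (leqnn N))/= /ltW DN].
exists (D N); split => //.
- by apply: closed_bigsetU => n _; case: (CA n).
- rewrite /D -bigcup_mkord => x [n _ Cn]; exists n => //.
  by have [_ + _] := CA n; apply.
Qed.

(** The sets approximable from inside together with their complements form a
    sigma-algebra; it contains the open sets, which are countable unions of
    closed sets. *)
Lemma borel_closed_approx A : measurable A -> closed_approx A.
Proof.
pose G := [set B | [/\ measurable B, closed_approx B & closed_approx (~` B)]].
suff : @measurable _ (borelType X) `<=` G by move=> mG /mG[].
apply: smallest_sub; first split.
- split => //; first exact/closed_approx_closed/closed0.
  by rewrite setC0; exact/closed_approx_closed/closedT.
- move=> B [mB aB aCB]; split; rewrite setTD ?setCK//.
  exact: measurableC.
- move=> B BG; split.
  + by apply: bigcupT_measurable => n; case: (BG n).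
  + by apply: closed_approx_bigcup => n; case: (BG n).
  + rewrite setC_bigcup; apply: closed_approx_bigcap => n; case: (BG n) => //.
    by move=> *; exact: measurableC.
move=> U oU; split.
- exact: sub_sigma_algebra.
- have [F cF ->] := open_Fsigma oU.
  apply: closed_approx_bigcup => n; first exact: closed_borel.
  exact: closed_approx_closed.
- by apply: closed_approx_closed; exact: open_closedC.
Qed.

Hypothesis cX : compact [set: X].

(** Take for M the union of closed subsets of A and of its complement: these are
    disjoint and compact, hence at positive distance from each other. *)
Lemma borel_locally_constant (A : set (borelType X)) e :
  measurable A -> 0 < e ->
  exists M : set X, [/\ closed M, (mu (~` M) <= e%:E)%E &
    exists2 d : R, 0 < d & forall x y, M x -> M y -> mdist x y < d ->
      A x <-> A y].
Proof.
move=> mA e0; have e20 : 0 < e / 2 by rewrite divr_gt0.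
have mcA : measurable (~` A) by exact: measurableC.
have [C [cC CA AC]] := borel_closed_approx mA e20.
have [D [cD DA AD]] := borel_closed_approx mcA e20.
have mC := closed_borel cC; have mD := closed_borel cD.
exists (C `|` D); split; first exact: closedU.
  apply: (@le_trans _ _ (mu ((A `\` C) `|` (~` A `\` D)))).
    apply: le_measure; rewrite ?inE.
    - by apply: measurableC; exact: measurableU.
    - by apply: measurableU; exact: measurableD.
    by move=> x nCD; have [Ax|nAx] := pselect (A x); [left|right];
      split => // ?; apply: nCD; [left|right].
  apply: (le_trans (measureU2 _ _ _)); try exact: measurableD.
  by rewrite [e]splitr EFinD leeD.
have CD : C `&` D = set0 by apply/seteqP; split => // x [/CA Ax /DA].
have compC : compact C by apply: (subclosed_compact cC cX).
have [r r0 apart] := compact_closed_apart compC cD CD.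
exists r => //.
move=> x y [Cx|Dx] [Cy|Dy] xy.
- by split => _; exact: CA.
- by have := apart x y Cx Dy; rewrite leNgt xy.
- by have := apart y x Cy Dx; rewrite leNgt metric_sym xy.
- by split => [Ax|Ay]; [have := DA x Dx|have := DA y Dy].
Qed.

(** Intersect the sets given by [borel_locally_constant] for errors forming a
    geometric series, and a closed subset of Z. *)
Lemma borel_locally_constant_seq (A : nat -> set (borelType X))
    (Z : set (borelType X)) (e : R) :
  0 < e -> (forall k, measurable (A k)) -> measurable Z -> mu (~` Z) = 0%E ->
  exists M : set X, [/\ compact M, M `<=` Z, ((1 - e)%:E < mu M)%E &
    forall k, exists2 d : R, 0 < d & forall x y, M x -> M y -> mdist x y < d ->
      A k x <-> A k y].
Proof.
move=> e0 mA mZ Z0.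
have e20 : 0 < e / 2 by rewrite divr_gt0.
have e40 : 0 < e / 4 by rewrite divr_gt0.
have [C [cC CZ ZC]] := borel_closed_approx mZ e40.
have /choice[M MA] : forall n, exists M : set X, [/\ closed M,
    (mu (~` M) <= ((e / 2) / (2 ^ n.+1)%:R)%:E)%E &
    exists2 d : R, 0 < d & forall x y, M x -> M y -> mdist x y < d ->
      A n x <-> A n y].
  move=> n; apply: borel_locally_constant => //.
  by rewrite divr_gt0// ltr0n expn_gt0.
have mC : measurable (C : set (borelType X)) by exact: closed_borel.
have mM n : measurable (M n : set (borelType X)).
  by apply: closed_borel; case: (MA n).
have cM : closed (C `&` \bigcap_n M n).
  by apply: closedI => //; apply: closed_bigI => n _; case: (MA n).
exists (C `&` \bigcap_n M n); split.
- exact: subclosed_compact cM cX _.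
- by move=> x [/CZ].
- have mCM := closed_borel cM.
  have fM : mu (C `&` \bigcap_n M n) \is a fin_num by apply: fin_num_measure.
  have mcM n : measurable (~` M n : set (borelType X)) by exact: measurableC.
  have : (mu (~` (C `&` \bigcap_n M n)) <= (e / 4 + e / 2)%:E)%E.
    apply: (@le_trans _ _ (mu (((~` Z) `|` (Z `\` C)) `|` \bigcup_n ~` M n))).
      apply: le_measure; rewrite ?inE.
      - exact: measurableC.
      - apply: measurableU; last exact: bigcupT_measurable.
        by apply: measurableU; [exact: measurableC|exact: measurableD].
      rewrite setCI setC_bigcap; apply: setSU => x nCx.
      by have [Zx|nZx] := pselect (Z x); [right|left].
    apply: (le_trans (measureU2 _ _ _)) => /=.
    - by apply: measurableU; [exact: measurableC|exact: measurableD].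
    - exact: bigcupT_measurable.
    rewrite EFinD; apply: leeD; last first.
      apply: measure_bigcup_geometric => //; first exact: ltW.
      by move=> n; case: (MA n).
    apply: (le_trans (measureU2 _ _ _)) => /=.
    - exact: measurableC.
    - exact: measurableD.
    by rewrite Z0 add0e.
  rewrite probability_setC// -(fineK fM) -EFinB lee_fin lte_fin; lra.
- move=> k; have [_ _ [d d0 dA]] := MA k; exists d => // x y [_ Mx] [_ My].
  by apply: dA; [exact: Mx|exact: My].
Qed.

End Regularity.

(** * Finite Borel partitions and the weak-mean pseudometric *)

Section Cells.
Context {R : realType} {X : pmetricType R}.
Implicit Types (s : seq X) (r : R).

Lemma compact_net r : compact [set: X] -> 0 < r ->
  exists s, forall x, has (fun c => mdist c x < r) s.
Proof.
rewrite compact_cover => cX r0.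
have [||D _ XD] := cX X setT (fun c => [set x | mdist c x < r]).
- by move=> c _; exact: open_mdist_ball.
- by move=> x _; exists x => //=; rewrite mdistxx.
exists (finmap.enum_fset D) => x; have [c /= cD cx] := XD x I.
by apply/hasP; exists c.
Qed.

Lemma compact_diameter : compact [set: X] ->
  exists2 D : R, 0 <= D & forall x y : X, mdist x y <= D.
Proof.
move=> cX; have [s sX] := compact_net cX ltr01.
pose B := \sum_(c <- s) mdist (point : X) c + 1.
have xB (x : X) : mdist point x <= B.
  have /hasP[c cs cx] := sX x.
  apply: (le_trans (metric_triangle _ c _)); apply: lerD; last exact: ltW.
  rewrite (big_rem c)//= lerDl; apply: sumr_ge0 => ? _; exact: mdist_ge0.
exists (B + B).
  by apply: addr_ge0; apply: le_trans (xB point); exact: mdist_ge0.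
move=> x y; apply: (le_trans (metric_triangle _ point _)).
by rewrite lerD// metric_sym.
Qed.

Lemma find_near_measurable s r i :
  measurable
    ([set x | find (fun c => mdist c x < r) s = i] : set (borelType X)).
Proof.
elim: s i => [|c s IH] i /=.
  have [->|i0] := eqVneq i 0%N.
    by rewrite (_ : [set _ | _] = setT)// predeqE.
  rewrite (_ : [set _ | _] = set0)// predeqE => x /=; split => // /esym/eqP.
  by rewrite (negbTE i0).
have mc : measurable ([set x | mdist c x < r] : set (borelType X)).
  by apply: sub_sigma_algebra; exact: open_mdist_ball.
case: i => [|i].
  rewrite (_ : [set _ | _] = [set x | mdist c x < r])// predeqE => x /=.
  by case: ifP.
rewrite (_ : [set _ | _] = (~` [set x | mdist c x < r]) `&`
    [set x | find (fun c => mdist c x < r) s = i]).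
  by apply: measurableI => //; exact: measurableC.
rewrite predeqE => x /=; case: ifP => cx.
  by split => // -[].
by split => [[<-]//|[_ ->]].
Qed.

(** The cell of x is the index of the first ball of a finite net that contains
    x. *)
Lemma exists_borel_cells e : compact [set: X] -> 0 < e ->
  exists m (h : X -> nat), [/\ forall x, (h x < m)%N,
    forall x y, h x = h y -> mdist x y <= e &
    forall i, measurable ([set x | h x = i] : set (borelType X))].
Proof.
move=> cX e0; have e20 : 0 < e / 2 by rewrite divr_gt0.
have [s sX] := compact_net cX e20.
exists (size s), (fun x => find (fun c => mdist c x < e / 2) s); split.
- by move=> x; rewrite -has_find.
- move=> x y xy; have /= cx := nth_find point (sX x).
  have /= cy := nth_find point (sX y); rewrite -xy in cy; move: cx cy.
  set c := nth _ _ _ => cx cy; apply: (le_trans (metric_triangle x c y)).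
  by rewrite [e]splitr; apply: lerD; [rewrite metric_sym|]; exact: ltW.
- exact: find_near_measurable.
Qed.

End Cells.

Section WeakMeanBound.
Context {R : realType} {X : metricType R} (T : X -> X).

(** Matched points in a common cell cost at most e, the others at most D, and
    [exists_matching] bounds the number of the latter by c for each of the
    m cells. *)
Lemma inf_matching_le m (h : X -> nat) (e D : R) n x y (c : R) :
  0 <= e -> 0 <= D -> 0 <= c -> (forall x, (h x < m)%N) ->
  (forall x y, h x = h y -> mdist x y <= e) ->
  (forall x y : X, mdist x y <= D) ->
  (forall i, visits T [set z | h z = i] n x -
             visits T [set z | h z = i] n y <= c) ->
  inf (range (fun s : 'S_n =>
    \sum_(k < n) mdist (iter k T x) (iter (s k) T y))) <=
  n%:R * e + m%:R * c * D.
Proof.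
move=> e0 D0 c0 hm he hD hc.
pose u (z : X) (k : 'I_n) := Ordinal (hm (iter k T z)).
have [s us] := exists_matching (u x) (u y).
apply: (@le_trans _ _ (\sum_(k < n) mdist (iter k T x) (iter (s k) T y))).
  apply: ge_inf; last by exists s.
  by exists 0 => _ [t _ <-]; apply: sumr_ge0 => k _; exact: mdist_ge0.
apply: (@le_trans _ _ (\sum_(k < n) (e + (u x k != u y (s k))%:R * D))).
  apply: ler_sum => k _; case: eqVneq => [uE|_] /=; last first.
    by rewrite mul1r (le_trans (hD _ _))// lerDr.
  by rewrite mul0r addr0; apply: he; have /(congr1 val) := uE.
rewrite big_split/= sumr_const card_ord mulr_natl lerD2l -mulr_suml.
apply: ler_wpM2r => //; rewrite -natr_sum.
have cardE z i :
    #|[set k | u z k == i]%SET|%:R = visits T [set w | h w = i] n z :> R.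
  rewrite -sum1_card natr_sum big_mkcond; apply: eq_bigr => k _.
  rewrite inE indicE (_ : (_ \in _) = (u z k == i)); first by case: ifP.
  by apply/idP/eqP => [/set_mem /= ki|<-]; [exact: val_inj|exact/mem_set].
have -> : (\sum_(k < n) (u x k != u y (s k)) =
    #|[set k | u x k != u y (s k)]%SET|)%N.
  by rewrite -sum1_card [RHS]big_mkcond; apply: eq_bigr => k _; rewrite inE.
apply: (@le_trans _ _ (\sum_(i < m) c)); last first.
  by rewrite sumr_const card_ord mulr_natl.
apply: le_trans (_ : (\sum_(i < m) (#|[set k | u x k == i]%SET| -
  #|[set k | u y k == i]%SET|))%N%:R <= _); first by rewrite ler_nat.
rewrite natr_sum; apply: ler_sum => i _.
have [le|/ltnW lt] :=
    leqP #|[set k | u x k == i]%SET| #|[set k | u y k == i]%SET|.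
  by move: le; rewrite -subn_eq0 => /eqP->.
by rewrite natrB// !cardE.
Qed.

Lemma limn_esup_le_near (u : nat -> \bar R) (c : \bar R) :
  (\forall n \near \oo, (u n <= c)%E) -> (limn_esup u <= c)%E.
Proof.
move=> uc; apply: (@le_trans _ _ (ereal_sup (u @` [set n | (u n <= c)%E]))).
  by apply: ereal_inf_lbound; exists [set n | (u n <= c)%E].
by apply: ub_ereal_sup => _ [n /= ? <-].
Qed.

(** The second e absorbs the contribution m C D / n of the additive constant C,
    which vanishes in the limit. *)
Lemma weak_mean_dist_le m (h : X -> nat) (e D eta : R) (C : nat) x y :
  0 < e -> 0 <= D -> 0 <= eta -> (forall x, (h x < m)%N) ->
  (forall x y, h x = h y -> mdist x y <= e) ->
  (forall x y : X, mdist x y <= D) ->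
  (forall i n, visits T [set z | h z = i] n x -
               visits T [set z | h z = i] n y <= eta * n%:R + C%:R) ->
  (weak_mean_dist T x y <= (e + m%:R * eta * D + e)%:E)%E.
Proof.
move=> e0 D0 eta0 hm he hD hC; apply: limn_esup_le_near.
have ge0 : 0 <= m%:R * C%:R * D / e by rewrite divr_ge0 ?(ltW e0)// !mulr_ge0.
exists (Num.truncn (m%:R * C%:R * D / e)).+1 => // n.
rewrite /mkset truncn_lt_nat// => ltn.
have n0 : 0 < n%:R :> R by exact: le_lt_trans ltn.
move: ltn; rewrite ltr_pdivrMr// => ltn.
have c0 : 0 <= eta * n%:R + C%:R by rewrite addr_ge0// mulr_ge0.
rewrite lee_fin mulrC ler_pdivrMr//.
apply: le_trans (inf_matching_le (ltW e0) D0 c0 hm he hD (fun i => hC i n)) _.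
by move: ltn; move: (m%:R) (C%:R) (n%:R) => M CC N; lra.
Qed.

End WeakMeanBound.

(** * Equicontinuity on a large compact set *)

Lemma continuous_borel_measurable {R : realType} {X : pmetricType R}
    (T : X -> X) :
  continuous T -> measurable_fun setT (T : borelType X -> borelType X).
Proof.
move=> /continuousP cT.
apply: (@measurability _ _ (borelType X) (borelType X) _ T (@open X)) => //.
move=> _ [U oU <-]; rewrite setTI; apply: sub_sigma_algebra; exact: cT.
Qed.

Lemma uniform_radius_seq {R : realType} (I : eqType) (Q : I -> R -> Prop)
    (s : seq I) :
  (forall i d d', d' <= d -> Q i d -> Q i d') ->
  (forall i, exists2 d, 0 < d & Q i d) ->
  exists2 d, 0 < d & forall i, i \in s -> Q i d.
Proof.
move=> Qle Qex; elim: s => [|i s [d d0 ds]]; first by exists 1.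
have [r r0 ri] := Qex i; exists (Num.min d r); first by rewrite lt_min d0.
move=> j; rewrite inE => /predU1P[->|js].
  by apply: Qle ri; rewrite ge_min lexx orbT.
by apply: Qle (ds j js); rewrite ge_min lexx.
Qed.

Theorem theorem3p8 (R : realType) (X : pmetricType R) (T : X -> X)
    (mu : probability (borelType X) R) :
  compact [set: X] -> continuous T -> invariant_measure T mu ->
  mu_F_equicontinuous T mu.
Proof.
move=> cX cT muT tau tau0.
have mT := continuous_borel_measurable cT.
have [D D0 hD] := compact_diameter cX.
have /choice[ch hP] : forall j : nat, exists mh : nat * (X -> nat),
    [/\ forall x, (mh.2 x < mh.1)%N,
    forall x y, mh.2 x = mh.2 y -> mdist x y <= j.+1%:R^-1 &
    forall i, measurable ([set x | mh.2 x = i] : set (borelType X))].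
  move=> j; have j0 : 0 < j.+1%:R^-1 :> R by rewrite invr_gt0.
  by have [m [h mh]] := exists_borel_cells cX j0; exists (m, h).
pose cell j i : set (borelType X) := [set x | (ch j).2 x = i].
have mcell j i : measurable (cell j i) by have [_ _] := hP j; apply.
(* A quadruple (j, i, l, K) stands for cell i of the j-th partition and the
   frequency level l / K.+1. *)
pose idx := (nat * nat * nat * nat)%type.
pose A (q : idx) : set (borelType X) :=
  excess T (cell q.1.1.1 q.1.1.2) (q.1.2%:R / q.2.+1%:R : R).
pose G (q : idx) : set (borelType X) :=
  excess T (cell q.1.1.1 q.1.1.2) (q.1.2.+1%:R / q.2.+1%:R : R) `&`
  excess T (~` cell q.1.1.1 q.1.1.2) (1 - q.1.2%:R / q.2.+1%:R : R).
have mA q : measurable (A q) by exact: measurable_excess.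
have mG q : measurable (G q).
  by apply: measurableI; apply: measurable_excess => //; exact: measurableC.
have G0 q : mu (G q) = 0%E.
  apply: measure_excess_gap => //.
  by rewrite ltr_pM2r ?invr_gt0// ltr_nat.
pose q0 : idx := (0, 0, 0, 0)%N.
pose of_nat (k : nat) : idx := odflt q0 (unpickle k).
have pickleE q : of_nat (pickle q) = q by rewrite /of_nat pickleK.
pose Z := ~` \bigcup_k G (of_nat k).
have mUG : measurable (\bigcup_k G (of_nat k)) by exact: bigcupT_measurable.
have Z0 : mu (~` Z) = 0%E.
  rewrite /Z setCK; apply/eqP; rewrite -measure_le0.
  apply: (@measure_bigcup_geometric _ R (borelType X) mu) => // k.
  by rewrite mul0r le_eqVlt; apply/orP; left; exact/eqP/G0.
have [M [cM MZ muM MA]] := @borel_locally_constant_seq R X mu cX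
  (fun k => A (of_nat k)) Z tau tau0 (fun k => mA _) (measurableC mUG) Z0.
exists M; split => // e e0.
(* Each of the three terms of the bound in [weak_mean_dist_le] gets e / 4. *)
pose j := Num.truncn (4 / e).
have j0 : 0 < j.+1%:R^-1 :> R by rewrite invr_gt0.
have je : j.+1%:R^-1 <= e / 4 :> R.
  by rewrite -[e / 4]invrK invf_div lef_pV2 ?posrE ?divr_gt0// ltW// truncnS_gt.
set m := (ch j).1; have [hm hh _] := hP j.
pose K := Num.truncn (m%:R * 2 * D * (4 / e)).
have eta0 : 0 <= 2 / K.+1%:R :> R by rewrite divr_ge0.
have Ke : m%:R * (2 / K.+1%:R) * D <= e / 4.
  rewrite mulrA mulrAC ler_pdivrMr// -ler_pdivrMl ?divr_gt0// invf_div mulrC.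
  exact/ltW/truncnS_gt.
have [d d0 dA] := @uniform_radius_seq R idx
  (fun q d => forall x y, M x -> M y -> mdist x y < d -> A q x <-> A q y)
  [seq (j, i, l, K) | i <- iota 0 m, l <- iota 0 K.+1]
  (fun q d d' dd' H x y Mx My xy => H x y Mx My (lt_le_trans xy dd'))
  (fun q => ltac:(by rewrite -(pickleE q); exact: MA)).
exists d => // x y Mx My xy.
have /choice[C hC] : forall i : 'I_m, exists C : nat, forall n,
    visits T (cell j i) n x - visits T (cell j i) n y <=
      2 / K.+1%:R * n%:R + C%:R :> R.
  move=> i; apply: visits_close_of_levels => [l lK|l ly].
    apply: (dA (j, nat_of_ord i, l, K)) => //; apply/allpairsP.
    by exists (nat_of_ord i, l); rewrite !mem_iota/= !add0n ltnS lK ltn_ord.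
  apply: (MZ y My); exists (pickle (j, nat_of_ord i, l, K)) => //.
  by rewrite pickleE.
pose CC := (\sum_(i < m) C i)%N.
have hCC i n : visits T (cell j i) n x - visits T (cell j i) n y <=
    2 / K.+1%:R * n%:R + CC%:R :> R.
  have [im|mi] := ltnP i m.
    apply: le_trans (hC (Ordinal im) n) _; rewrite lerD2l ler_nat.
    by rewrite /CC (bigD1 (Ordinal im))//= leq_addr.
  have cell0 : cell j i = set0.
    rewrite predeqE => z; split => // zi; have := hm z.
    by rewrite zi ltnNge mi.
  rewrite cell0 /visits !big1 ?subrr ?addr_ge0// ?mulr_ge0// => k _;
    by rewrite indic0.
apply: (@le_lt_trans _ _
  (j.+1%:R^-1 + m%:R * (2 / K.+1%:R) * D + j.+1%:R^-1)%:E).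
  exact: weak_mean_dist_le hCC.
rewrite lte_fin; move: je Ke; move: (j.+1%:R^-1) (_ * D) => u v; lra.
Qed.
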